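(* All squares are exceptional. Specifically, for a square $ABCD$ the four measurements $|AB|$, $|AC|$, $|AD|$, $\angle BCD$ distinguish it among all quadrilaterals: if $A'B'C'D'$ is a quadrilateral in the plane with $|A'B'|=|AB|$, $|A'C'|=|AC|$, $|A'D'|=|AD|$ and $\angle B'C'D'=\angle BCD$, then $A'B'C'D'$ is congruent to $ABCD$ (with vertices corresponding in the given order).
   Context: A quadrilateral $A'B'C'D'$ is given by its sequence of four distinct vertices in the plane. For a convex polygon $A_1A_2\cdots A_n$ (or more generally a sequence of distinct points in the plane), the simple measurements are: (1) distances $|A_iA_j|$, $i\ne j$; (2) angles $\angle A_iA_jA_k\in[0,\pi]$ for $i,j,k$ distinct; (3) ''diagonal angles'' between $A_iA_j$ and $A_kA_l$. An $n$-gon is called exceptional if it can be described locally (that is, determined up to isometry among all sufficiently nearby sequences of $n$ points) by fewer than $2n-3$ simple measurements; for quadrilaterals this means fewer than $5$. *)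

(* Defs.v *)
From mathcomp Require Import all_boot all_order all_algebra.
From mathcomp Require Import reals trigo.

Set Implicit Arguments.
Unset Strict Implicit.
Unset Printing Implicit Defensive.

Import Order.TTheory GRing.Theory Num.Theory.
Local Open Scope ring_scope.

Section Plane.
Variable R : realType.

(* The library norm on matrices is the sup norm, so the Euclidean norm of the
   plane 'rV[R]_2 is defined here. *)
Definition dot (u v : 'rV[R]_2) : R := (u *m v^T) 0 0.

Definition enorm (u : 'rV[R]_2) : R := Num.sqrt (dot u u).

Definition edist (P Q : 'rV[R]_2) : R := enorm (P - Q).

(* Angle between two vectors, in [0, pi]. If u or v is 0 then division by 0
   makes this acos 0 = pi / 2, so distinctness of the points concerned always
   has to be assumed separately. *)
Definition vangle (u v : 'rV[R]_2) : R := acos (dot u v / (enorm u * enorm v)).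

Definition angle (P Q S : 'rV[R]_2) : R := vangle (P - Q) (S - Q).

Definition isometry (f : 'rV[R]_2 -> 'rV[R]_2) : Prop :=
  forall P Q, edist (f P) (f Q) = edist P Q.

Definition congruent n (A B : n.-tuple 'rV[R]_2) : Prop :=
  exists2 f, isometry f & forall i, tnth B i = f (tnth A i).

Definition is_square (A B C D : 'rV[R]_2) : Prop :=
  [/\ uniq [:: A; B; C; D],
      [/\ edist A B = edist B C, edist B C = edist C D & edist C D = edist D A]
    & [/\ angle D A B = pi / 2, angle A B C = pi / 2,
          angle B C D = pi / 2 & angle C D A = pi / 2]].

End Plane.

Inductive measurement (n : nat) :=
| Distance of 'I_n & 'I_n
| Angle of 'I_n & 'I_n & 'I_n
| DiagonalAngle of 'I_n & 'I_n & 'I_n & 'I_n.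

(* When A_iA_j and A_kA_l share an endpoint, their angle or its supplement is
   already an Angle; hence the four indices of a DiagonalAngle are distinct. *)
Definition admissible n (m : measurement n) : bool :=
  match m with
  | Distance i j => i != j
  | Angle i j k => uniq [:: i; j; k]
  | DiagonalAngle i j k l => uniq [:: i; j; k; l]
  end.

Definition measure (R : realType) n (A : n.-tuple 'rV[R]_2)
    (m : measurement n) : R :=
  match m with
  | Distance i j => edist (tnth A i) (tnth A j)
  | Angle i j k => angle (tnth A i) (tnth A j) (tnth A k)
  | DiagonalAngle i j k l =>
      vangle (tnth A j - tnth A i) (tnth A l - tnth A k)
  end.

Definition describes_locally (R : realType) n (A : n.-tuple 'rV[R]_2)
    (s : seq (measurement n)) : Prop :=
  exists2 eps : R, 0 < eps &
    forall B : n.-tuple 'rV[R]_2,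
      (forall i, edist (tnth A i) (tnth B i) < eps) ->
      map (measure B) s = map (measure A) s ->
      congruent A B.

Definition exceptional (R : realType) n (A : n.-tuple 'rV[R]_2) : Prop :=
  exists s : seq (measurement n),
    [/\ all (@admissible n) s, (size s < 2 * n - 3)%N & describes_locally A s].

(* Main.v *)
Require Import Defs.
From mathcomp Require Import all_boot all_order all_algebra.
From mathcomp Require Import reals trigo.
From mathcomp Require Import lra.

(** Put A' at the origin, and let b, c, d be the other vertices, with
    |b|^2 = |d|^2 = t and |c|^2 = 2t.  If (b - c).(d - c) = 0, then
    |c - (b + d)|^2 = |b|^2 + |d|^2 - |c|^2 + 2 (b - c).(d - c) = 0.  Hence
    c = b + d, and |c|^2 = 2t then gives b.d = 0.  So the rows b, d have the
    same Gram matrix for both quadrilaterals, and an orthogonal map matches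
    them.  The same four measurements describe the square locally. *)

Set Implicit Arguments.
Unset Strict Implicit.
Unset Printing Implicit Defensive.

Import Order.TTheory GRing.Theory Num.Theory.
Local Open Scope ring_scope.

Section Plane.
Variable R : realType.
Implicit Types u v b c d P Q : 'rV[R]_2.

Lemma dotE u v : dot u v = u 0 0 * v 0 0 + u 0 1 * v 0 1.
Proof.
rewrite /dot mxE big_ord_recl big_ord1 !mxE.
by congr (_ + u _ _ * v _ _); apply: val_inj.
Qed.

Lemma dotC u v : dot u v = dot v u.
Proof. by rewrite !dotE mulrC [u 0 1 * _]mulrC. Qed.

Lemma dotNN u v : dot (- u) (- v) = dot u v.
Proof. by rewrite !dotE !mxE !mulrNN. Qed.

Lemma dot_ge0 u : 0 <= dot u u.
Proof. by rewrite dotE -!expr2 addr_ge0 // sqr_ge0. Qed.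

Lemma dot_eq0 u : (dot u u == 0) = (u == 0).
Proof.
apply/eqP/eqP => [|->]; last by rewrite dotE !mxE !mulr0 addr0.
rewrite dotE => /eqP; rewrite -!expr2 paddr_eq0 ?sqr_ge0 // !sqrf_eq0.
case/andP=> /eqP u0 /eqP u1; apply/rowP; case=> [[|[|//]] i]; rewrite mxE.
- by rewrite -[RHS]u0; congr (u _ _); apply: val_inj.
- by rewrite -[RHS]u1; congr (u _ _); apply: val_inj.
Qed.

Lemma enorm_sqr u : enorm u ^+ 2 = dot u u.
Proof. by rewrite sqr_sqrtr ?dot_ge0. Qed.

Lemma eq_enorm u v : enorm u = enorm v -> dot u u = dot v v.
Proof. by rewrite -!enorm_sqr => ->. Qed.

Lemma enormN u : enorm (- u) = enorm u.
Proof. by rewrite /enorm dotNN. Qed.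

Lemma edistC P Q : edist P Q = edist Q P.
Proof. by rewrite /edist -enormN opprB. Qed.

Lemma cauchy_schwarz u v : `|dot u v| <= enorm u * enorm v.
Proof.
rewrite -[leRHS]ger0_norm ?mulr_ge0 ?sqrtr_ge0 // -ler_sqr ?nnegrE //.
rewrite !real_normK ?num_real // exprMn !enorm_sqr !dotE -subr_ge0.
(* Lagrange's identity: the gap between the squared sides is the square of the determinant of [u]
   and [v]. *)
have := sqr_ge0 (u 0 0 * v 0 1 - u 0 1 * v 0 0); lra.
Qed.

(** If a norm vanishes, division by zero makes the angle [acos 0], that is [pi / 2], and the dot
    product is 0 as well. Otherwise Cauchy-Schwarz puts the quotient in [-1, 1], where [cos] undoes
    [acos]. *)
Lemma vangle_right u v : vangle u v = pi / 2 -> dot u v = 0.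
Proof.
have cs := cauchy_schwarz u v; rewrite /vangle => /(congr1 (@cos R)).
have [n0|n_neq0] := eqVneq (enorm u * enorm v) 0.
  by move: cs; rewrite n0 normr_le0 => /eqP.
have n_gt0 : 0 < enorm u * enorm v.
  by rewrite lt_def n_neq0 mulr_ge0 ?sqrtr_ge0.
rewrite acosK; last first.
  by rewrite in_itv /= -ler_norml normrM normfV (gtr0_norm n_gt0)
    ler_pdivrMr // mul1r.
rewrite cos_pihalf => /eqP; rewrite mulf_eq0 invr_eq0 (negbTE n_neq0) orbF.
by move/eqP.
Qed.

Lemma right_angle_closes_square t b c d :
    dot b b = t -> dot c c = t *+ 2 -> dot d d = t ->
  dot (b - c) (d - c) = 0 -> c = b + d /\ dot b d = 0.
Proof.
move=> bb cc dd; rewrite dotE !mxE => perp.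
have cE : c = b + d.
  apply/eqP; rewrite -subr_eq0 -dot_eq0; apply/eqP.
  by move: bb cc dd perp; rewrite !dotE !mxE; lra.
split=> //; move: cc bb dd; rewrite cE !dotE !mxE; lra.
Qed.

(** One matrix equation gathers the dot products, so that two quadrilaterals can be compared through
    [t] alone. For nonzero [t] it also exhibits the inverse of the matrix with rows [b] and [d]. *)
Lemma gram_orthogonal t b d :
    dot b b = t -> dot d d = t -> dot b d = 0 ->
  col_mx b d *m (col_mx b d)^T = t%:M.
Proof.
rewrite /dot tr_col_mx mul_col_row => bb dd bd.
have db : (d *m b^T) 0 0 = 0 by rewrite -bd; apply: dotC.
rewrite [b *m b^T]mx11_scalar [d *m d^T]mx11_scalar.
rewrite [b *m d^T]mx11_scalar [d *m b^T]mx11_scalar bb dd bd db.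
by rewrite scalar_mx_block !raddf0.
Qed.

End Plane.

(** With U = M^-1 N, the product U U^T is M^-1 (N N^T) M^-T = M^-1 (M M^T) M^-T = 1. *)
Lemma eq_gram_orthogonal (F : comUnitRingType) n (M N : 'M[F]_n) :
    M \in unitmx -> M *m M^T = N *m N^T ->
  exists2 U : 'M[F]_n, M *m U = N & U *m U^T = 1%:M.
Proof.
move=> Mu MN; exists (invmx M *m N); first by rewrite mulKVmx.
rewrite trmx_mul mulmxA -(mulmxA _ N) -MN mulKmx // trmx_inv mulmxV //.
by rewrite unitmx_tr.
Qed.

(* Qualified because all_algebra exports another [isometry]. *)
Lemma orthogonal_isometry (R : realType) (U : 'M[R]_2) (P0 Q0 : 'rV[R]_2) :
  U *m U^T = 1%:M -> Defs.isometry (fun P => Q0 + (P - P0) *m U).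
Proof.
move=> UU P Q; rewrite /edist /enorm /dot opprD addrACA subrr add0r -mulmxBl.
by rewrite opprB addrA subrK trmx_mul mulmxA -(mulmxA _ U) UU mulmx1.
Qed.

Section Square.
Variables (R : realType) (A B C D : 'rV[R]_2).
Hypothesis sq : is_square A B C D.

Lemma square_diagonal :
  [/\ 0 < dot (B - A) (B - A), dot (D - A) (D - A) = dot (B - A) (B - A)
    & dot (C - A) (C - A) = dot (B - A) (B - A) *+ 2].
Proof.
case: sq => uniqABCD [ABBC BCCD CDDA] [_ /vangle_right ABC _ _].
have BA : B - A != 0.
  move: uniqABCD => /=; rewrite subr_eq0 eq_sym inE negb_or.
  by case/andP => /andP[].
split; first by rewrite lt_def dot_eq0 BA dot_ge0.
  by apply: eq_enorm; rewrite -[RHS]/(edist B A) edistC ABBC BCCD CDDA.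
(* Pythagoras in the triangle ABC, right-angled at B with equal legs. *)
move/eq_enorm: ABBC ABC; rewrite !dotE !mxE; lra.
Qed.

Lemma square_congruent (A' B' C' D' : 'rV[R]_2) :
    edist A' B' = edist A B -> edist A' C' = edist A C ->
    edist A' D' = edist A D -> angle B' C' D' = angle B C D ->
  congruent [tuple A; B; C; D] [tuple A'; B'; C'; D'].
Proof.
have [t_gt0 dd cc] := square_diagonal; have bb := erefl (dot (B - A) (B - A)).
(* Only the right-hand side of [bb] is named [t], so that both quadrilaterals satisfy equations of
   the same shape with a common [t]. *)
set t := {2}(dot _ _) in bb; rewrite -/t in t_gt0 dd cc.
case: sq => _ _ [_ _ BCD _]; rewrite BCD.
rewrite !(edistC A) !(edistC A') => /eq_enorm bb' /eq_enorm cc' /eq_enorm dd'.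
rewrite bb in bb'; rewrite cc in cc'; rewrite dd in dd'.
move/vangle_right => perp'; move/vangle_right: BCD => perp.
(* Moving the origin to A, respectively A', expresses the right angle at C, respectively C', through
   the vectors b, c, d. *)
have shift (P Q S : 'rV[R]_2) : P - Q = P - S - (Q - S).
  by rewrite opprB addrA subrK.
rewrite (shift B _ A) (shift D _ A) in perp.
rewrite (shift B' _ A') (shift D' _ A') in perp'.
have [cE bd] := right_angle_closes_square bb cc dd perp.
have [cE' bd'] := right_angle_closes_square bb' cc' dd' perp'.
have G := gram_orthogonal bb dd bd; have G' := gram_orthogonal bb' dd' bd'.
have Mu : col_mx (B - A) (D - A) \in unitmx.
  have: col_mx (B - A) (D - A) *m (t^-1 *: (col_mx (B - A) (D - A))^T) = 1%:M.
    by rewrite -scalemxAr G scale_scalar_mx mulVf ?gt_eqF.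
  by case/mulmx1_unit.
have [U] := eq_gram_orthogonal Mu (etrans G (esym G')).
rewrite mul_col_mx => /eq_col_mx[bU dU] UU.
(* [U] is chosen to match only the sides at A. The vertex C then follows by linearity, since c = b +
   d in both quadrilaterals. *)
exists (fun P => A' + (P - A) *m U); first exact: orthogonal_isometry.
case=> [[|[|[|[|//]]]] i]; rewrite !(tnth_nth 0) /=.
- by rewrite subrr mul0mx addr0.
- by rewrite bU addrC subrK.
- by rewrite cE mulmxDl bU dU -cE' addrC subrK.
- by rewrite dU addrC subrK.
Qed.

End Square.

Theorem proposition3p5 (R : realType) (A B C D : 'rV[R]_2)
    (sqABCD : is_square A B C D) :
  exceptional [tuple A; B; C; D] /\
  forall A' B' C' D' : 'rV[R]_2,
    uniq [:: A'; B'; C'; D'] ->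
    edist A' B' = edist A B ->
    edist A' C' = edist A C ->
    edist A' D' = edist A D ->
    angle B' C' D' = angle B C D ->
    congruent [tuple A; B; C; D] [tuple A'; B'; C'; D'].
Proof.
split; last by move=> A' B' C' D' _; apply: square_congruent.
pose i k : 'I_4 := inord k.
(* Four measurements, against the bound 2 * 4 - 3 = 5. *)
exists [:: Distance (i 0) (i 1); Distance (i 0) (i 2); Distance (i 0) (i 3);
           Angle (i 1) (i 2) (i 3)]; split=> //.
  by rewrite /= !inE -!val_eqE /= !inordK.
(* The radius 1 is arbitrary: these measurements determine the square globally. *)
exists 1 => // -[[|A' [|B' [|C' [|D' [|//]]]]] //= sz] _.
rewrite !(tnth_nth 0) /= !inordK //= => -[AB AC AD BCD].
have -> : @Tuple 4 _ [:: A'; B'; C'; D'] sz = [tuple A'; B'; C'; D'].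
  exact: val_inj.
exact: square_congruent.
Qed.
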